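(* Let $f:\mathbb R\to\mathbb R$ be locally of bounded variation. Then, for any integers $a<b$, $$\sum_{a\le k<b}f_m(k)=\int_a^b f(x)\,dx-\frac12\big(f(b^-)-f(a^-)\big)+\int_{(a,b)}\beta_1(x)\,d\mu_f(x).$$
   Context: A function $f:\mathbb R\to\mathbb R$ is locally of bounded variation if on every bounded interval $I$ its pointwise variation $\sup\{\sum_{0\le i<n}|f(t_{i+1})-f(t_i)|:\ t_i\in I,\ t_0<\dots<t_n\}$ is finite. Then the one-sided limits $f(x^-)$ (left) and $f(x^+)$ (right) exist at every $x\in\mathbb R$. The mid-value modification of $f$ is $$f_m(x):=\frac{f(x^-)+f(x^+)}2 .$$ $\mu_f$ denotes the associated signed measure, finite on the Borel subsets of any bounded interval, determined by: for $c<d$, $$\mu_f((c,d))=f(d^-)-f(c^+),\quad \mu_f([c,d])=f(d^+)-f(c^-),\quad \mu_f([c,d))=f(d^-)-f(c^-),\quad \mu_f((c,d])=f(d^+)-f(c^+),$$ and $\mu_f(\{c\})=f(c^+)-f(c^-)$. The function $\beta_1:\mathbb R\to\mathbb R$ is $$\beta_1(x):=\begin{cases}x-[x]-\frac12&\text{if }x\notin\mathbb Z,\\ 0&\text{if }x\in\mathbb Z,\end{cases}$$ where $[x]$ is the integer part (floor) of $x$. For integers $a<b$, $\sum_{a\le k<b}$ denotes $\sum_{k=a}^{b-1}$. *)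

(* Defs.v *)
From HB Require Import structures.
From mathcomp Require Import all_boot all_order all_algebra.
From mathcomp Require Import all_classical all_reals all_analysis.
Import Order.TTheory GRing.Theory Num.Theory.
Import numFieldNormedType.Exports.

Set Implicit Arguments.
Unset Strict Implicit.
Unset Printing Implicit Defensive.

Local Open Scope classical_set_scope.
Local Open Scope ring_scope.

(* The library's [bounded_variation c d f] bounds the variations of f along the
   subdivisions of [c, d] from c to d.  Since each bounded interval lies in such
   a compact one, quantifying over c and d covers all bounded intervals. *)
Definition locally_bounded_variation (R : realType) (f : R -> R) : Prop :=
  forall c d : R, bounded_variation c d f.

(* The filters x^'- and x^'+ exclude the point x itself. *)
Definition left_lim (R : realType) (f : R -> R) (x : R) : R := lim (f @ x^'-).
Definition right_lim (R : realType) (f : R -> R) (x : R) : R := lim (f @ x^'+).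

Definition mid_value (R : realType) (f : R -> R) (x : R) : R :=
  (left_lim f x + right_lim f x) / 2.

Definition beta1 (R : realType) (x : R) : R :=
  if x \is a Num.int then 0 else x - (Num.floor x)%:~R - 1 / 2.

(* A signed measure defined and finite on the bounded Borel sets only; the values
   of [lf_fun] on other sets are irrelevant.  The library's charges are finite on
   the whole Borel sigma-algebra, which would exclude e.g. f(x) = x. *)
Record lf_charge (R : realType) := LFCharge {
  lf_fun :> set (measurableTypeR R) -> \bar R ;
  lf_charge0 : lf_fun set0 = 0%E ;
  lf_charge_finite : forall (c d : R) (A : set (measurableTypeR R)),
    measurable A -> A `<=` `[c, d] -> lf_fun A \is a fin_num ;
  lf_charge_sigma_additive :
    forall (c d : R) (F : nat -> set (measurableTypeR R)),
    (forall i, measurable (F i)) -> (forall i, F i `<=` `[c, d]) ->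
    trivIset setT F ->
    (fun n => \sum_(0 <= i < n) lf_fun (F i))%E @ \oo
      --> lf_fun (\bigcup_i F i) }.

Definition lf_restr (R : realType) (mu : lf_charge R) (c d : R)
    (A : set (measurableTypeR R)) : \bar R :=
  mu (A `&` `]c, d[).

Section lf_restr_charge.
Context (R : realType) (mu : lf_charge R) (c d : R).

Let subcc (A : set R) : A `&` `]c, d[ `<=` `[c, d].
Proof. by move=> x [_]; exact: subset_itv_oo_cc. Qed.

Let restr0 : lf_restr mu c d set0 = 0%E.
Proof. by rewrite /lf_restr set0I lf_charge0. Qed.

Let restr_fin (A : set (measurableTypeR R)) :
  measurable A -> lf_restr mu c d A \is a fin_num.
Proof.
move=> mA; apply: (@lf_charge_finite _ _ c d); last exact: subcc.
by apply: measurableI => //; exact: measurable_itv.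
Qed.

Let restr_sigma : semi_sigma_additive (lf_restr mu c d).
Proof.
move=> F mF tF _; rewrite /lf_restr setI_bigcupl.
apply: (@lf_charge_sigma_additive _ _ c d) => [i|i|].
- by apply: measurableI => //; exact: measurable_itv.
- exact: subcc.
- exact: trivIset_setIr.
Qed.

HB.instance Definition _ :=
  isCharge.Build _ (measurableTypeR R) R (lf_restr mu c d)
    restr0 restr_fin restr_sigma.

End lf_restr_charge.

(* Integral against a finite signed measure through its Jordan decomposition,
   which does not depend on the Hahn decomposition picked here. *)
Definition charge_integral (d : measure_display) (T : measurableType d)
    (R : realType) (nu : {charge set T -> \bar R}) (D : set T) (g : T -> R) : R :=
  let HP := cid (Hahn_decomposition nu) in
  let HN := cid (svalP HP) in
  \int[jordan_pos (svalP HN)]_(x in D) g x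
  - \int[jordan_neg (svalP HN)]_(x in D) g x.

(* Only the values of mu on Borel subsets of the open interval matter. *)
Definition lf_integral_oo (R : realType) (mu : lf_charge R) (c d : R)
    (g : R -> R) : R :=
  charge_integral (lf_restr mu c d) `]c, d[ g.

(* These values determine mu on all bounded Borel sets. *)
Record stieltjes_charge_of (R : realType) (f : R -> R) (mu : lf_charge R) :
    Prop := StieltjesChargeOf {
  stieltjes_oo : forall c d : R, c < d ->
    mu `]c, d[%classic = (left_lim f d - right_lim f c)%:E ;
  stieltjes_cc : forall c d : R, c < d ->
    mu `[c, d]%classic = (right_lim f d - left_lim f c)%:E ;
  stieltjes_co : forall c d : R, c < d ->
    mu `[c, d[%classic = (left_lim f d - left_lim f c)%:E ;
  stieltjes_oc : forall c d : R, c < d ->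
    mu `]c, d]%classic = (right_lim f d - right_lim f c)%:E ;
  stieltjes_set1 : forall c : R,
    mu [set c] = (right_lim f c - left_lim f c)%:E }.

(* Main.v *)
(* Restricted to the open interval (a, b), the charge mu_f is a difference of two
   finite measures.  On that interval beta1 is x - a - 1/2 minus half the sum of
   the indicators of [k, b) and (k, b) over the integers a < k < b.  Integrated
   against a finite measure m, the indicators give masses of tails, and by Fubini
   x - a gives the Lebesgue integral of m((t, b)) over (a, b).  For mu_f the tail
   mass of (t, b) is f(b^-) - f(t^+), and f(t^+) = f(t) for all but countably many
   t, since f is a difference of monotone functions; the rest is algebra. *)
Require Import Defs.
From mathcomp Require Import all_boot all_order all_algebra.
From mathcomp Require Import all_classical all_reals all_analysis.
From mathcomp Require Import measurable_realfun lra zify.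
Import Order.TTheory GRing.Theory Num.Theory.
Import numFieldNormedType.Exports.
Local Open Scope classical_set_scope.
Local Open Scope ring_scope.

(** * The linear part of [beta1], by Fubini *)

(* Fubini: x - c is the length of the set of t with c < t < x. *)
Lemma Rintegral_sub_endpoint (R : realType)
    (m : {finite_measure set (measurableTypeR R) -> \bar R}) (c d : R) :
  \int[m]_(x in `]c, d[) (x - c)
  = \int[lebesgue_measure]_(t in `]c, d[) fine (m `](t : R), d[%classic).
Proof.
(* The triangle c < t < x < d, with t Lebesgue-distributed in the first coordinate and x weighted by
   [m] in the second. The section at x is ]c, x[, of length x - c; the section at t is the tail ]t,
   d[. *)
pose E : set (measurableTypeR R * measurableTypeR R) :=
  [set p | c < p.1 /\ p.1 < p.2 < d].
have mE : measurable E.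
  have -> : E = (setT `&` [set p | c < p.1]) `&`
      ((setT `&` [set p | p.1 < p.2]) `&` (setT `&` [set p | p.2 < d])).
    apply/seteqP; split=> p /=.
      by move=> [cp /andP[pp pd]]; split; [split|split; split].
    by move=> [[_ cp] [[_ pp] [_ pd]]]; split=> //; apply/andP.
  have ltE (g h : measurableTypeR R * measurableTypeR R -> R) :
      measurable_fun setT g -> measurable_fun setT h ->
      measurable (setT `&` [set p | g p < h p]).
    move=> mg mh; have mgh := measurable_fun_ltr mg mh.
    exact: (mgh measurableT [set true] I).
  apply: measurableI; first exact: (ltE (cst c) fst).
  by apply: measurableI; [exact: (ltE fst snd)|exact: (ltE snd (cst d))].
have /esym := @indic_fubini_tonelli _ _ _ _ R (@lebesgue_measure R) m E mE.
rewrite indic_fubini_tonelli_FE// indic_fubini_tonelli_GE// => FG.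
rewrite /Rintegral; congr fine.
transitivity (\int[m]_y (lebesgue_measure \o ysection E) y)%E.
  rewrite [LHS]integral_mkcond; apply: eq_integral => x _ /=.
  rewrite patchE mem_setE in_itv/=; case: ifPn => [/andP[cx xd]|].
    have -> : ysection E x = `]c, x[%classic.
      apply/seteqP; split=> t; rewrite /ysection/= in_itv/= inE /E/=.
        by move=> [-> /andP[->]].
      by move=> /andP[-> ->].
    by rewrite lebesgue_measure_itv/= lte_fin cx.
  rewrite negb_and -!leNgt => xcd.
  rewrite (_ : ysection E x = set0) ?measure0//.
  apply/seteqP; split=> t //; rewrite /ysection/= inE/= => -[ct /andP[tx xd]].
  by case/orP: xcd; rewrite leNgt ?xd// (lt_trans ct).
rewrite FG [RHS]integral_mkcond; apply: eq_integral => t _ /=.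
rewrite patchE mem_setE in_itv/=; case: ifPn => [/andP[ct td]|].
  rewrite fineK ?fin_num_measure//; congr (m _).
  apply/seteqP; split=> x; rewrite /xsection/= in_itv/= inE /E/=.
    by move=> [_ ->].
  by move=> ->.
rewrite negb_and -!leNgt => tcd.
rewrite (_ : xsection E t = set0) ?measure0//.
apply/seteqP; split=> x //; rewrite /xsection/= inE/= => -[ct /andP[tx xd]].
by case/orP: tcd; rewrite leNgt ?ct// (lt_trans tx).
Qed.

(** * [beta1] as a combination of indicators of tails *)

Lemma int_itv_natP (R : realType) (a : int) (n : nat) (x : R) :
  a%:~R <= x < (a + n%:Z)%:~R ->
  exists2 p : nat, (p < n)%N & (a + p%:Z)%:~R <= x < (a + p.+1%:Z)%:~R.
Proof.
elim: n => [|n IH /andP[ax xn]].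
  by rewrite addr0 => /andP[ax /(le_lt_trans ax)]; rewrite ltxx.
have [xn'|nx] := ltP x (a + n%:Z)%:~R; last by exists n; rewrite // nx.
by have [|p pn] := IH; [rewrite ax|exists p => //; exact: ltnW].
Qed.

Lemma sum_ltn_min (n p : nat) : (\sum_(i < n) (i < p)%N = minn n p)%N.
Proof.
elim: n => [|n IH]; first by rewrite big_ord0 min0n.
by rewrite big_ord_recr/= IH; lia.
Qed.

(* The half-open and open tails each carry half of the jump of the floor at an
   integer, which yields the value 0 of beta1 there. *)
Lemma beta1_indic (R : realType) (a : int) (n : nat) (x : R) :
  a%:~R < x < (a + n.+1%:Z)%:~R ->
  @beta1 R x = (x - a%:~R) - 1 / 2 - 1 / 2 * \sum_(i < n)
    (\1_`[(a + i.+1%:Z)%:~R, (a + n.+1%:Z)%:~R[ x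
     + \1_`](a + i.+1%:Z)%:~R, (a + n.+1%:Z)%:~R[ x).
Proof.
move=> /andP[ax xb].
have [p pn /andP[px xp]] := @int_itv_natP R a n.+1 x ltac:(by rewrite ltW).
have fx : Num.floor x = a + p%:Z.
  by apply: floor_def; rewrite px -addrA -PoszD addn1.
(* As a + p <= x < a + p + 1, the tail closed at a + i + 1 contains x exactly when i < p; the bound
   p <= n makes the count equal to p. *)
have S1 : \sum_(i < n) (\1_`[(a + i.+1%:Z)%:~R, (a + n.+1%:Z)%:~R[ x : R) = p%:R.
  transitivity ((\sum_(i < n) (i < p)%N)%N%:R : R); last first.
    by rewrite sum_ltn_min; congr _%:R; lia.
  rewrite natr_sum; apply: eq_bigr => i _.
  rewrite indicE mem_setE in_itv/= xb andbT; congr (nat_of_bool _)%:R.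
  apply/idP/idP => [ix|ip]; last first.
    by apply: le_trans px; rewrite ler_int lerD2l lez_nat.
  by have := le_lt_trans ix xp; rewrite ltr_int ltrD2l ltz_nat ltnS.
rewrite /beta1 fx big_split/= S1; have [xint|xint] := boolP (x \is a Num.int).
  have xE : x = (a + p%:Z)%:~R by rewrite -fx floorK.
  (* At the integer x = a + p the open tail starting at x misses x, so only p - 1 open tails count.
     Positivity of p makes this predecessor a true subtraction. *)
  have p0 : (0 < p)%N.
    by move: ax; rewrite xE ltr_int ltrDl ltz_nat.
  have -> : \sum_(i < n) (\1_`](a + i.+1%:Z)%:~R, (a + n.+1%:Z)%:~R[ x : R)
      = p.-1%:R.
    transitivity ((\sum_(i < n) (i < p.-1)%N)%N%:R : R); last first.
      by rewrite sum_ltn_min; congr _%:R; lia.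
    rewrite natr_sum; apply: eq_bigr => i _.
    rewrite indicE mem_setE in_itv/= xb andbT; congr (nat_of_bool _)%:R.
    by rewrite xE ltr_int ltrD2l ltz_nat; lia.
  have pE : p%:R = p.-1%:R + 1 :> R by rewrite natr1 prednK.
  by rewrite xE intrD -pmulrn pE; lra.
have -> : \sum_(i < n) (\1_`](a + i.+1%:Z)%:~R, (a + n.+1%:Z)%:~R[ x : R)
    = p%:R.
  rewrite -S1; apply: eq_bigr => i _.
  rewrite !indicE !mem_setE !in_itv/= xb !andbT lt_neqAle.
  by have [xE|] := eqVneq; [move: xint; rewrite -xE intr_int|].
by rewrite intrD -pmulrn; lra.
Qed.

(** * Integration of [beta1] against a finite measure *)

Lemma Rintegral_sum d (T : measurableType d) (R : realType)
    (m : {measure set T -> \bar R}) (D : set T) (mD : measurable D)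
    (I : Type) (s : seq I) (h : I -> T -> R) :
  (forall i, m.-integrable D (EFin \o h i)) ->
  \int[m]_(x in D) (\sum_(i <- s) h i x) = \sum_(i <- s) \int[m]_(x in D) h i x.
Proof.
move=> ih; rewrite /Rintegral; under eq_integral do rewrite -sumEFin.
rewrite integral_sum//.
rewrite -sum_fine; first by [].
by move=> i _; exact: (integrable_fin_num mD (ih i)).
Qed.

Lemma integrable_indic_in d (T : measurableType d) (R : realType)
    (m : {finite_measure set T -> \bar R}) (D S : set T) :
  measurable D -> measurable S -> m.-integrable D (EFin \o (\1_S : T -> R)).
Proof.
move=> mD mS; apply: (@integrableS _ _ _ _ setT) => //.
exact: integrable_indic.
Qed.

Lemma Rintegral_indic_sub d (T : measurableType d) (R : realType)
    (m : {measure set T -> \bar R}) (D S : set T) :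
  measurable D -> measurable S -> S `<=` D ->
  \int[m]_(x in D) (\1_S x : R) = fine (m S).
Proof. by move=> mD mS SD; rewrite /Rintegral integral_indic// setIidl. Qed.

(** Linearity applied to [beta1_indic]. The result involves [m] only through masses of tails, the
    quantities that a Stieltjes charge prescribes. *)
Lemma Rintegral_beta1 (R : realType)
    (m : {finite_measure set (measurableTypeR R) -> \bar R}) (a : int)
    (n : nat) (c : R := a%:~R) (d : R := (a + n.+1%:Z)%:~R) :
  \int[m]_(x in `]c, d[) @beta1 R x
  = \int[lebesgue_measure]_(t in `]c, d[) fine (m `](t : R), d[%classic)
    - 1 / 2 * fine (m `]c, d[%classic)
    - 1 / 2 * \sum_(i < n) (fine (m `[(a + i.+1%:Z)%:~R, d[%classic)
                            + fine (m `](a + i.+1%:Z)%:~R, d[%classic)).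
Proof.
have mD : measurable (`]c, d[%classic : set (measurableTypeR R)).
  exact: measurable_itv.
have icst (r : R) : m.-integrable `]c, d[ (EFin \o cst r).
  exact: finite_measure_integrable_cst.
have isub : m.-integrable `]c, d[ (EFin \o (fun x : R => x - c)).
  apply: measurable_bounded_integrable => //.
  - by rewrite ltey_eq fin_num_measure.
  - exact: measurable_funB.
  - exists (d - c); split; first exact: num_real.
    move=> M dM x /=; rewrite in_itv/= => /andP[cx xd].
    rewrite ger0_norm ?subr_ge0 1?ltW//; apply: lt_trans dM.
    by rewrite ltrD2r.
pose u (i : nat) : set (measurableTypeR R) := `[(a + i.+1%:Z)%:~R, d[%classic.
pose v (i : nat) : set (measurableTypeR R) := `](a + i.+1%:Z)%:~R, d[%classic.
have cE (i : nat) : c < (a + i.+1%:Z)%:~R by rewrite ltr_int ltrDl ltz_nat.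
have mU (i : nat) : measurable (u i) by exact: measurable_itv.
have mV (i : nat) : measurable (v i) by exact: measurable_itv.
have iu (i : nat) : m.-integrable `]c, d[ (EFin \o (\1_(u i) : R -> R)).
  exact: integrable_indic_in.
have iv (i : nat) : m.-integrable `]c, d[ (EFin \o (\1_(v i) : R -> R)).
  exact: integrable_indic_in.
have iuv (i : nat) : m.-integrable `]c, d[
    (EFin \o (fun x : R => (\1_(u i) x + \1_(v i) x) : R)).
  exact: (integrableD mD (iu i) (iv i)).
have isum : m.-integrable `]c, d[
    (EFin \o (fun x : R => \sum_(i < n) (\1_(u i) x + \1_(v i) x) : R)).
  rewrite (_ : EFin \o _ =
      fun x => (\sum_(i < n) (\1_(u i) x + \1_(v i) x)%:E)%E); last first.
    by apply/funext => x /=; rewrite sumEFin.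
  by apply: integrable_sum => // i _; exact: iuv.
transitivity (\int[m]_(x in `]c, d[)
    ((x - c) - 1 / 2 - 1 / 2 * \sum_(i < n) (\1_(u i) x + \1_(v i) x))).
  apply: eq_Rintegral => x; rewrite inE/= in_itv/=; exact: beta1_indic.
rewrite RintegralB//; last 2 first.
  exact: (integrableB mD isub (icst _)).
  exact: (integrableZl mD (1 / 2) isum).
rewrite RintegralB//; last exact: (icst (1 / 2)).
congr (_ - _ - _).
- exact: Rintegral_sub_endpoint.
- exact: Rintegral_cst.
transitivity (1 / 2 *
    \int[m]_(x in `]c, d[) (\sum_(i < n) (\1_(u i) x + \1_(v i) x))).
  exact: RintegralZl.
rewrite Rintegral_sum//; congr (_ * _).
apply: eq_bigr => i _; rewrite RintegralD//.
congr (_ + _); rewrite Rintegral_indic_sub//.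
  by move=> x; rewrite /u/= !in_itv/= => /andP[/(lt_le_trans (cE i)) -> ->].
by move=> x; rewrite /v/= !in_itv/= => /andP[/(lt_trans (cE i)) -> ->].
Qed.

(** Hides the chosen Hahn decomposition: these two identities let formulas for finite measures be
    subtracted to give formulas for the charge. *)
Lemma charge_integral_jordan d (T : measurableType d) (R : realType)
    (nu : {charge set T -> \bar R}) :
  exists m1 m2 : {finite_measure set T -> \bar R},
    (forall A, measurable A -> fine (nu A) = fine (m1 A) - fine (m2 A)) /\
    (forall D g, charge_integral nu D g =
      \int[m1]_(x in D) g x - \int[m2]_(x in D) g x).
Proof.
set HP := cid (Hahn_decomposition nu); set HN := cid (svalP HP).
exists (jordan_pos (svalP HN)), (jordan_neg (svalP HN)); split=> // A mA.
rewrite (jordan_decomp (svalP HN) mA) /cadd/= cscaleN1 fineD ?fineN//.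
  exact: fin_num_measure.
by rewrite fin_numN; exact: fin_num_measure.
Qed.

(** * Monotone functions and functions of bounded variation *)

Section monotone.
Context (R : realType) (c d : R) (F : R -> R).
Hypothesis ndF : {in `[c, d] &, nondecreasing_fun F}.

(** A discontinuity here means that the left and right limits differ. Monotonicity places F x
    between these limits, so their equality forces F x to be the right limit. *)
Lemma nondecreasing_at_right_continuous x : x \in `]c, d[ ->
  ~ discontinuity F x -> F y @[y --> x^'+] --> F x.
Proof.
move=> xcd; move: (xcd); rewrite in_itv/= => /andP[cx xd] ndx.
have xcc : x \in `[c, d] by exact: subset_itv_oo_cc.
have cvgr : cvg (F y @[y --> x^'+]).
  apply: nondecreasing_at_right_is_cvgr; near=> s.
    apply: itv_sub_in2 ndF; apply: subset_itvW; first exact: ltW.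
    by near: s; exact: nbhs_right_le.
  exists (F x) => _ /= [y xys <-]; apply: ndF => //.
    apply: (subset_itvW _ _ (ltW cx) _ xys).
    by near: s; exact: nbhs_right_le.
  by move: xys; rewrite in_itv/= => /andP[/ltW].
have cvgl : cvg (F y @[y --> x^'-]).
  apply: nondecreasing_at_left_is_cvgr; near=> s.
    apply: itv_sub_in2 ndF; apply: subset_itvW; last exact: ltW.
    by near: s; exact: nbhs_left_ge.
  exists (F x) => _ /= [y xys <-]; apply: ndF => //.
    apply: (subset_itvW _ _ _ (ltW xd) xys).
    by near: s; exact: nbhs_left_ge.
  by move: xys; rewrite in_itv/= => /andP[_ /ltW].
have lFx : lim (F y @[y --> x^'-]) <= F x.
  apply: limr_le => //; near=> y; apply: ndF => //.
  rewrite in_itv/=; apply/andP; split; first by near: y; exact: nbhs_left_ge.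
  by apply: (@le_trans _ _ x); [near: y; exact: nbhs_left_le|exact: ltW].
have Fxr : F x <= lim (F y @[y --> x^'+]).
  apply: limr_ge => //; near=> y; apply: ndF => //.
  rewrite in_itv/=; apply/andP; split; last by near: y; exact: nbhs_right_le.
  by apply: (@le_trans _ _ x); [exact: ltW|near: y; exact: nbhs_right_ge].
have lr : lim (F y @[y --> x^'-]) = lim (F y @[y --> x^'+]).
  by apply/eqP/negPn/negP => lr; apply: ndx.
suff -> : F x = lim (F y @[y --> x^'+]) by [].
by apply/eqP; rewrite eq_le Fxr/= -lr.
Unshelve. all: by end_near. Qed.

Lemma nondecreasing_in_measurable : measurable_fun `[c, d] F.
Proof.
have [cd|dc] := leP c d; last first.
  rewrite set_itv_ge; first exact: measurable_fun_set0.
  by rewrite bnd_simp -ltNge.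
(* Composing with the projection onto [c, d] extends F to a function monotone on the whole line,
   which is measurable. *)
pose clamp x := Num.max c (Num.min x d).
have clampP x : clamp x \in `[c, d].
  by rewrite in_itv/= /clamp le_max lexx/= ge_max cd/= ge_min lexx orbT.
apply: (@eq_measurable_fun _ _ _ _ _ (F \o clamp)) => [x|].
  rewrite inE/= in_itv/= => /andP[cx xd]; congr F.
  by rewrite /clamp min_l// max_r.
apply: nondecreasing_measurable => // x y xy /=; apply: ndF => //.
by rewrite /clamp ge_max !le_max lexx/= le_min !ge_min xy lexx !orbT.
Qed.

End monotone.

Section bounded_variation.
Context (R : realType) (c d : R) (f : R -> R).
Hypothesis bvf : bounded_variation c d f.

(** Jordan decomposition: F and G are half the sum and half the difference of the total variation
    from c and f. Since [pos_tv] is [neg_tv] of -f, one monotonicity result serves both. *)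
Lemma bounded_variation_monotoneE : exists F G : R -> R,
  [/\ {in `[c, d] &, nondecreasing_fun F}, {in `[c, d] &, nondecreasing_fun G}
    & {in `[c, d], f =1 F \- G}].
Proof.
exists (fine \o pos_tv c f), (fine \o neg_tv c f); split.
- by apply: fine_neg_tv_nondecreasing; exact: bounded_variationN.
- exact: fine_neg_tv_nondecreasing.
- exact: bounded_variation_pos_neg_tvE.
Qed.

Lemma bounded_variation_measurable : measurable_fun `[c, d] f.
Proof.
have [F [G [ndF ndG fE]]] := bounded_variation_monotoneE.
apply: (@eq_measurable_fun _ _ _ _ _ (F \- G)) => [x|].
  by rewrite inE/= => /fE.
by apply: measurable_funB; exact: nondecreasing_in_measurable.
Qed.

Lemma bounded_variation_right_lim :
  exists2 N : set R, countable N &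
    forall x, x \in `]c, d[ -> ~ N x -> right_lim f x = f x.
Proof.
have [F [G [ndF ndG fE]]] := bounded_variation_monotoneE.
(* A monotone function has countably many discontinuities; away from those of F and G both are
   right-continuous, hence so is F - G. *)
exists (\bigcup_(H in [set F; G]) [set x | x \in (`]c, d[) /\ discontinuity H x]).
  apply: bigcup_countable => [|H [->|->]]; last 2 first.
  - exact: discontinuity_countable.
  - exact: discontinuity_countable.
  exact/finite_set_countable/finite_set2.
move=> x xcd nFG.
have nF : ~ discontinuity F x by move=> dF; apply: nFG; exists F => //; left.
have nG : ~ discontinuity G x by move=> dG; apply: nFG; exists G => //; right.
move: (xcd); rewrite in_itv/= => /andP[cx xd].
rewrite (fE x)//; last exact: subset_itv_oo_cc.
apply: cvg_lim => //.
apply: cvg_trans; last first.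
  exact: (cvgB (nondecreasing_at_right_continuous _ _ _ _ ndF x xcd nF)
               (nondecreasing_at_right_continuous _ _ _ _ ndG x xcd nG)).
apply: near_eq_cvg; near=> y; rewrite fE// in_itv/=; apply/andP; split.
  by apply: (@le_trans _ _ x); [exact: ltW|near: y; exact: nbhs_right_ge].
by near: y; exact: nbhs_right_le.
Unshelve. all: by end_near. Qed.

End bounded_variation.

(** * Tail masses and their Lebesgue integrals *)

Lemma lebesgue_measure_oo_lty (R : realType) (c d : R) :
  (lebesgue_measure (`]c, d[%classic : set R) < +oo)%E.
Proof.
by rewrite lebesgue_measure_itv/=; case: ifPn => // _; rewrite -EFinB ltry.
Qed.

(** The tail mass is nonincreasing in t, hence measurable, and on ]c, d[ it is bounded by its value
    at c. *)
Lemma integrable_measure_tail (R : realType)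
    (m : {finite_measure set (measurableTypeR R) -> \bar R}) (c d : R) :
  lebesgue_measure.-integrable `]c, d[
    (EFin \o (fun t : R => fine (m `]t, d[%classic))).
Proof.
have m_fin (A : set (measurableTypeR R)) : measurable A -> m A \is a fin_num.
  exact: fin_num_measure.
have mitv (t : R) : measurable (`]t, d[%classic : set (measurableTypeR R)).
  exact: measurable_itv.
have tail_le (s t : R) : s <= t ->
    fine (m `]t, d[%classic) <= fine (m `]s, d[%classic).
  move=> st; apply: fine_le; rewrite ?m_fin//.
  by apply: le_measure; rewrite ?inE//; apply: subset_itvr; rewrite bnd_simp.
apply: measurable_bounded_integrable => //.
- exact: lebesgue_measure_oo_lty.
- apply: nonincreasing_measurable => // s t st; exact: tail_le.
- exists (fine (m `]c, d[%classic)); split; first exact: num_real.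
  move=> M cM t /=; rewrite in_itv/= => /andP[ct td].
  by rewrite ger0_norm ?fine_ge0// (le_trans _ (ltW cM))// tail_le// ltW.
Qed.

Section stieltjes_tail.
Context (R : realType) (f : R -> R) (mu : lf_charge R).
Hypotheses (hf : locally_bounded_variation f) (hmu : stieltjes_charge_of f mu).
Variables c d : R.

Lemma lf_restr_tail_oo x : c <= x -> x < d ->
  fine (lf_restr mu c d `]x, d[%classic) = left_lim f d - right_lim f x.
Proof.
move=> cx xd; rewrite /lf_restr setIidl ?(stieltjes_oo hmu)//.
by apply: subset_itvr; rewrite bnd_simp.
Qed.

Lemma lf_restr_tail_co x : c < x -> x < d ->
  fine (lf_restr mu c d `[x, d[%classic) = left_lim f d - left_lim f x.
Proof.
move=> cx xd; rewrite /lf_restr setIidl ?(stieltjes_co hmu)//.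
by apply: subset_itvr; rewrite bnd_simp.
Qed.

(** The integrands differ by f(d^-) - f(t^+), which equals f(d^-) - f(t) off a countable, hence
    Lebesgue-null, set of t. *)
Lemma Rintegral_lf_restr_tail
    (m1 m2 : {finite_measure set (measurableTypeR R) -> \bar R}) :
  c < d ->
  (forall A : set (measurableTypeR R), measurable A ->
    fine (lf_restr mu c d A) = fine (m1 A) - fine (m2 A)) ->
  \int[lebesgue_measure]_(t in `]c, d[) fine (m1 `](t : R), d[%classic)
  - \int[lebesgue_measure]_(t in `]c, d[) fine (m2 `](t : R), d[%classic)
  = left_lim f d * (d - c) - \int[lebesgue_measure]_(x in `[c, d]) f x.
Proof.
move=> cd mE.
have mcd : measurable (`]c, d[%classic : set (measurableTypeR R)).
  exact: measurable_itv.
pose g (t : R) := fine (m1 `]t, d[%classic) - fine (m2 `]t, d[%classic).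
have ig : lebesgue_measure.-integrable `]c, d[ (EFin \o g).
  exact: (integrableB mcd (integrable_measure_tail _ m1 c d)
    (integrable_measure_tail _ m2 c d)).
have icst : lebesgue_measure.-integrable `]c, d[ (EFin \o cst (left_lim f d)).
  apply: measurable_bounded_integrable => //.
    exact: lebesgue_measure_oo_lty.
  exists `|left_lim f d|; split; first exact: num_real.
  by move=> M /ltW LM x _.
have mf := bounded_variation_measurable _ _ _ _ (hf c d).
have -> : \int[lebesgue_measure]_(x in `[c, d]) f x =
    \int[lebesgue_measure]_(x in `]c, d[) (left_lim f d - g x).
  have mfoo : measurable_fun `]c, d[ (EFin \o f).
    apply/measurable_EFinP; apply: measurable_funS mf => //.
    exact: subset_itv_oo_cc.
  (* The endpoints are Lebesgue-null, and the tail formula is compared with f only inside ]c, d[. *)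
  rewrite /Rintegral integral_itv_bndoo//; congr fine.
  apply: ae_eq_integral => //.
    by have /measurable_int := integrableB mcd icst ig.
  have [N cN fN] := bounded_variation_right_lim _ _ _ _ (hf c d).
  exists N; split.
  - by apply: countable_measurable.
  - exact: countable_lebesgue_measure0.
  - move=> x /= /not_implyP[xcd]; apply: contra_notP => nN.
    move: (xcd); rewrite in_itv/= => /andP[cx xd].
    by rewrite -(fN x)// /g -mE// lf_restr_tail_oo// 1?ltW// opprB addrC subrK.
rewrite RintegralB// Rintegral_cst//= lebesgue_measure_itv/= lte_fin cd/=.
rewrite /g RintegralB//; [|exact: integrable_measure_tail..].
by rewrite opprB addrCA subrr addr0.
Qed.

End stieltjes_tail.

(** * Assembly of the summation formula *)

Lemma fsbig_int_itv (R : realType) (h : int -> R) (a : int) (n : nat) :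
  \sum_(k \in [set k : int | a <= k < a + n%:Z]) h k
  = \sum_(i < n) h (a + i%:Z).
Proof.
rewrite (fsbig_ord _ n (fun i => h (a + i%:Z))).
apply: reindex_fsbig; split.
- by move=> i /= ni; rewrite lerDl ltrD2l ltz_nat ni.
- by move=> i j _ _ /addrI[].
- move=> k /= /andP[ak kan]; exists `|k - a|%N; lia.
Qed.

Theorem theorem3p4 (R : realType) (f : R -> R)
    (hf : locally_bounded_variation f)
    (mu_f : lf_charge R) (hmu : stieltjes_charge_of f mu_f)
    (a b : int) (hab : a < b) :
  \sum_(k \in [set k : int | a <= k < b]) mid_value f k%:~R
  = \int[lebesgue_measure]_(x in `[a%:~R, b%:~R]) f x
    - 1 / 2 * (left_lim f b%:~R - left_lim f a%:~R)
    + lf_integral_oo mu_f a%:~R b%:~R (@beta1 R).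
Proof.
(* Writing b - a as n + 1 builds in a < b and lists the interior integers as a + i + 1 with i <
   n. *)
have [n bE] : exists n : nat, b = a + n.+1%:Z.
  by exists (absz (b - a)).-1; lia.
rewrite {}bE {b hab} in hab *; set c : R := a%:~R; set d : R := (a + n.+1%:Z)%:~R.
have cd : c < d by rewrite ltr_int ltrDl ltz_nat.
have dE : d - c = n%:R + 1 by rewrite /d intrD -pmulrn addrC addKr natr1.
have [m1 [m2 [mE intE]]] := @charge_integral_jordan _ _ _ (lf_restr mu_f c d).
have tailE := @Rintegral_lf_restr_tail R f mu_f hf hmu c d m1 m2 cd mE.
have mitv (i : interval R) : measurable ([set` i] : set (measurableTypeR R)).
  exact: measurable_itv.
have ki (i : 'I_n) : c < (a + i.+1%:Z)%:~R < d.
  by rewrite !ltr_int ltrDl ltrD2l !ltz_nat /= ltnS ltn_ord.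
(* At an interior integer k the two tails together have mass 2 f(d^-) - f(k^-) - f(k^+) = 2 f(d^-) -
   2 f_m(k). *)
have sumE : \sum_(i < n) (fine (m1 `[(a + i.+1%:Z)%:~R, d[%classic)
      + fine (m1 `](a + i.+1%:Z)%:~R, d[%classic))
    - \sum_(i < n) (fine (m2 `[(a + i.+1%:Z)%:~R, d[%classic)
      + fine (m2 `](a + i.+1%:Z)%:~R, d[%classic))
    = 2 * left_lim f d * n%:R
      - 2 * \sum_(i < n) mid_value f (a + i.+1%:Z)%:~R.
  rewrite -sumrB mulr_sumr -[X in _ * X%:R](card_ord n) -sum1_card natr_sum.
  rewrite mulr_sumr -sumrB; apply: eq_bigr => i _; have /andP[ci di] := ki i.
  rewrite opprD addrACA -!mE//.
  rewrite (lf_restr_tail_co _ _ _ hmu)// (lf_restr_tail_oo _ _ _ hmu) ?ltW//.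
  rewrite /mid_value; lra.
have headE := lf_restr_tail_oo _ _ _ hmu c d c (lexx c) cd.
rewrite mE// in headE.
rewrite fsbig_int_itv big_ord_recl/= addr0 -/c.
have -> : \sum_(i < n) mid_value f (a + bump 0 i)%:~R
   = \sum_(i < n) mid_value f (a + i.+1%:Z)%:~R by [].
rewrite /lf_integral_oo intE !Rintegral_beta1 -/c -/d.
rewrite {1}/mid_value.
(* With d - c = n + 1, the charge integral contains f(d^-) with coefficient (n + 1) - 1/2 - n = 1/2,
   which cancels the boundary term at b. What remains at a is f(c^-)/2 + f(c^+)/2, the summand k =
   a. *)
rewrite dE in tailE.
lra.
Qed.
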